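(* Let $n\ge 3$ be odd and put $M=(n-1)^{n-1}$. Suppose that for every integer $x\ge 1$ $$\sum_{j=0}^{\frac{n-1}{2}}(-1)^j\binom{n}{2j+1}S_{n,0}\big((n-1)^{2j}x\big)=\sum_{j=0}^{n-1}S_{n,j}(x).$$ Let $J\subseteq\{1,2,\dots,\frac{n-3}{2}\}$ be any subset (possibly empty). For integers $x\ge 0$ and $0\le j\le \frac{n-3}{2}$ put $T_j(x)=S_{n,0}\big(\lfloor x/(n-1)^{n-1-2j}\rfloor\big)$ if $j\in J$ and $T_j(x)=S_{n,0}\big((n-1)^{2j}\lfloor x/M\rfloor\big)$ if $j\notin J$, and let $$\Sigma_J(x)=\sum_{j=0}^{\frac{n-3}{2}}(-1)^{\frac{n-3}{2}-j}\binom{n}{2j+1}T_j(x).$$ Define $\nu_n^{J}(x)=S_{n,0}(x)-\Sigma_J(x)$. Then the sequence $\big((-1)^{s_{n-1}(x)}\nu_n^{J}(x)\big)_{x\ge 0}$ is periodic with period $2n(n-1)^{n-1}$.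
   Context: For an integer $b\ge 2$ and integer $r\ge 0$, $s_b(r)$ denotes the sum of the digits of $r$ in base $b$. For integers $n\ge 3$, $0\le j\le n-1$ and $x\ge 0$, define $$S_{n,j}(x)=\sum_{0\le r<x,\; r\equiv j \pmod n}(-1)^{s_{n-1}(r)}.$$ *)

(* Defs.v *)
From mathcomp Require Import all_boot all_order all_algebra.

Set Implicit Arguments.
Unset Strict Implicit.
Unset Printing Implicit Defensive.

Import GRing.Theory.
Local Open Scope ring_scope.

(* The digit of index i of r in base b is (r %/ b ^ i) %% b; for b >= 2 it
   vanishes as soon as i >= r, because r < b ^ r, so r indices are enough. *)
Definition digit_sum (b r : nat) : nat :=
  (\sum_(0 <= i < r) (r %/ b ^ i) %% b)%N.

Definition Snj (n j x : nat) : int :=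
  \sum_(0 <= r < x | r == j %[mod n]) (-1) ^+ digit_sum n.-1 r.

Definition Tj (n : nat) (J : {pred nat}) (j x : nat) : int :=
  if j \in J then Snj n 0 (x %/ n.-1 ^ (n.-1 - 2 * j))
  else Snj n 0 (n.-1 ^ (2 * j) * (x %/ n.-1 ^ n.-1)).

Definition SigmaJ (n : nat) (J : {pred nat}) (x : nat) : int :=
  \sum_(0 <= j < (n - 3)./2.+1)
     (-1) ^+ ((n - 3)./2 - j) * 'C(n, 2 * j + 1)%:Z * Tj n J j x.

Definition nuJ (n : nat) (J : {pred nat}) (x : nat) : int :=
  Snj n 0 x - SigmaJ n J x.

(* Main.v *)
(* Put b = n - 1, M = b ^ b, sg r = (-1) ^ s_b(r), and write x = M q + t with
   t < M.  As b is even, b ^ k = 1 mod n for even k, and sg (b ^ k q + u) =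
   sg q * sg u for u < b ^ k; hence S_{n,0}(b ^ k q + u) - S_{n,0}(b ^ k q) is
   sg q times a quantity depending only on u and q mod n.  The recurrence at q
   expresses S_{n,0}(M q) through the S_{n,0}(b ^ 2j q) up to the sign of
   \sum_(r < q) sg r, which telescopes to 0 for even q and to - sg q for odd q.
   So sg x * nuJ x only depends on t, q mod n and the parity of q, that is, on
   x mod 2 n M. *)
Require Import Defs.
From mathcomp Require Import all_boot all_order all_algebra.
From mathcomp Require Import zify ring.

Set Implicit Arguments.
Unset Strict Implicit.
Unset Printing Implicit Defensive.

Import GRing.Theory.
Local Open Scope ring_scope.

(** Allows digit sums of different numbers to be compared over a common index range. *)
Lemma digit_sum_widen (b r N : nat) : (1 < b)%N -> (r <= N)%N ->
  digit_sum b r = (\sum_(0 <= i < N) (r %/ b ^ i) %% b)%N.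
Proof.
move=> b_gt1 le_rN; rewrite /digit_sum (@big_cat_nat _ _ _ r 0 N) //=.
rewrite [X in (_ + X)%N]big_nat_cond [X in (_ + X)%N]big1 ?addn0 // => i.
rewrite andbT => /andP[le_ri _]; rewrite divn_small ?mod0n //.
by apply: leq_ltn_trans le_ri _; apply: ltn_expl.
Qed.

Lemma digit_sum_rec (b a d : nat) : (1 < b)%N -> (d < b)%N ->
  digit_sum b (b * a + d) = (digit_sum b a + d)%N.
Proof.
move=> b_gt1 lt_db.
rewrite (@digit_sum_widen b (b * a + d) (b * a + d).+1) //.
rewrite big_nat_recl // expn0 divn1 mulnC modnMDl modn_small // addnC.
congr (_ + _)%N; rewrite (@digit_sum_widen b a (a * b + d)) //; last by nia.
apply: eq_big_nat => i _.
by rewrite expnS divnMA divnMDl ?(ltnW b_gt1) // (divn_small lt_db) addn0.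
Qed.

Lemma digit_sum_cat (b k q t : nat) : (1 < b)%N -> (t < b ^ k)%N ->
  digit_sum b (b ^ k * q + t) = (digit_sum b q + digit_sum b t)%N.
Proof.
move=> b_gt1; have b_gt0 := ltnW b_gt1.
elim: k t => [|k IHk] t lt_t.
  have ->: t = 0%N by move: lt_t; rewrite expn0; lia.
  by rewrite expn0 mul1n addn0 [digit_sum b 0]big_geq // addn0.
have lt_tb : (t %/ b < b ^ k)%N by rewrite ltn_divLR // -expnSr.
have lt_mb : (t %% b < b)%N by rewrite ltn_mod.
have {1}-> : (b ^ k.+1 * q + t = b * (b ^ k * q + t %/ b) + t %% b)%N.
  by rewrite {1}(divn_eq t b) expnS; lia.
rewrite digit_sum_rec // IHk // -addnA; congr (_ + _)%N.
by rewrite -digit_sum_rec // mulnC -divn_eq.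
Qed.

Definition digit_sign (b r : nat) : int := (-1) ^+ digit_sum b r.

Lemma digit_sign_sqr (b r : nat) : digit_sign b r * digit_sign b r = 1.
Proof. by rewrite -expr2 sqrr_sign. Qed.

Lemma digit_sign_cat (b k q t : nat) : (1 < b)%N -> (t < b ^ k)%N ->
  digit_sign b (b ^ k * q + t) = digit_sign b q * digit_sign b t.
Proof. by move=> b_gt1 lt_t; rewrite /digit_sign digit_sum_cat // exprD. Qed.

(** With [b] even, the last digit of an even [q] is even, hence is not [b - 1]: adding 1 causes no
    carry. *)
Lemma digit_sign_succ_even (b q : nat) : (1 < b)%N -> ~~ odd b -> ~~ odd q ->
  digit_sign b q.+1 = - digit_sign b q.
Proof.
move=> b_gt1 b_even q_even; have b_gt0 := ltnW b_gt1.
have lt_mb : (q %% b < b)%N by rewrite ltn_mod.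
have m_even : ~~ odd (q %% b) by rewrite odd_mod //; apply: negbTE.
have lt_Smb : ((q %% b).+1 < b)%N by lia.
rewrite /digit_sign.
have -> : q.+1 = (b * (q %/ b) + (q %% b).+1)%N.
  by rewrite {1}(divn_eq q b); lia.
have -> : digit_sum b q = digit_sum b (b * (q %/ b) + q %% b).
  by rewrite mulnC -divn_eq.
by rewrite !digit_sum_rec // addnS exprS mulN1r.
Qed.

(** The terms at [2 * i] and [2 * i + 1] cancel; for odd [q] the term at [q - 1] is left over, and
    it is opposite to the sign of [q]. *)
Lemma sum_digit_sign (b q : nat) : (1 < b)%N -> ~~ odd b ->
  \sum_(0 <= r < q) digit_sign b r = - (digit_sign b q * (odd q)%:Z).
Proof.
move=> b_gt1 b_even; elim: q => [|q IHq]; first by rewrite big_geq // mulr0 oppr0.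
rewrite big_nat_recr //= {}IHq.
have [q_odd|q_even] /= := boolP (odd q); first by rewrite mulr1 mulr0 addNr oppr0.
by rewrite digit_sign_succ_even // mulr0 mulr1 oppr0 add0r opprK.
Qed.

Lemma sum_Snj (n x : nat) : (0 < n)%N ->
  \sum_(0 <= j < n) Snj n j x = \sum_(0 <= r < x) digit_sign n.-1 r.
Proof.
move=> n_gt0; rewrite /Snj; under eq_bigr do rewrite big_mkcond /=.
rewrite exchange_big /=; apply: eq_bigr => r _.
have lt_rn : (r %% n < n)%N by rewrite ltn_mod.
rewrite big_mkord (bigD1 (Ordinal lt_rn)) //= modn_mod eqxx big1 ?addr0 //.
move=> i; rewrite -val_eqE /= => /negPf ne_ir.
by rewrite (modn_small (ltn_ord i)) eq_sym ne_ir.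
Qed.

(* The increment of S_{n,0} from b ^ k * q to b ^ k * q + t, up to the sign of
   q, when b ^ k = 1 mod n; it depends on q only modulo n. *)
Definition Sincr (n q t : nat) : int :=
  \sum_(0 <= r < t | (n %| q + r)%N) digit_sign n.-1 r.

Lemma Sincr_mod (n q q' t : nat) : (q = q' %[mod n])%N -> Sincr n q t = Sincr n q' t.
Proof.
by move=> eq_q; apply: eq_bigl => r; rewrite /dvdn -modnDml eq_q modnDml.
Qed.

(** [n - 1] is -1 modulo [n], so its square is 1. *)
Lemma predn_expn_even_mod (n k : nat) : (0 < n)%N -> ~~ odd k ->
  (n.-1 ^ k = 1 %[mod n])%N.
Proof.
move=> n_gt0 k_even; rewrite -(even_halfK k_even) -mul2n expnM -modnXm.
have -> : (n.-1 ^ 2 %% n = 1 %% n)%N; last by rewrite modnXm exp1n.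
case: n n_gt0 => // -[|m] _ /=; first by rewrite !modn1.
have -> : (m.+1 ^ 2 = m * m.+2 + 1)%N by lia.
by rewrite modnMDl.
Qed.

(** A new index [n.-1 ^ k * q + r] with [r < t] is congruent to [q + r] modulo [n], and its sign
    factors because [r] only fills the [k] low digits. *)
Lemma Snj0_cat (n k q t : nat) : (2 < n)%N -> ~~ odd k -> (t < n.-1 ^ k)%N ->
  Snj n 0 (n.-1 ^ k * q + t) =
    Snj n 0 (n.-1 ^ k * q) + digit_sign n.-1 q * Sincr n q t.
Proof.
move=> n_gt2 k_even lt_t.
rewrite /Snj (@big_cat_nat _ _ _ (n.-1 ^ k * q)%N 0) ?leq_addr //=; congr (_ + _).
rewrite /Sincr mulr_sumr -{1}[(n.-1 ^ k * q)%N]add0n big_addn addKn.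
rewrite big_nat_cond [RHS]big_nat_cond; apply: eq_big => [r|r].
  congr (_ && _); rewrite mod0n /dvdn; congr (_ == _).
  by rewrite addnC -modnDml -modnMml predn_expn_even_mod; [rewrite modnMml mul1n modnDml|lia|].
move=> /andP[/andP[_ lt_rt] _]; rewrite addnC -/(digit_sign _ _) digit_sign_cat //; lia.
Qed.

(** Puts the argument of [Tj] for [j \in J] in the form required by [Snj0_cat], with [l = 2 * j]. *)
Lemma divn_expn_split (b k l x : nat) : (0 < b)%N -> (l <= k)%N ->
  (x %/ b ^ (k - l) = b ^ l * (x %/ b ^ k) + (x %% b ^ k) %/ b ^ (k - l))%N.
Proof.
move=> b_gt0 le_lk; rewrite {1}(divn_eq x (b ^ k)).
have -> : (b ^ k = b ^ l * b ^ (k - l))%N by rewrite -expnD subnKC.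
by rewrite mulnA divnMDl ?expn_gt0 ?b_gt0 // mulnC.
Qed.

(** Here [a] stands for [q], seen only through [Sincr] and so modulo [n], and [e] for the parity of
    [q]. Indices outside [J] give 0, as their [Tj] has no increment. *)
Definition nuJ_reduced (n : nat) (J : {pred nat}) (a e t : nat) : int :=
  digit_sign n.-1 t * (Sincr n a t - (-1) ^+ n.-1./2 * e%:Z
    - \sum_(0 <= j < (n - 3)./2.+1) (-1) ^+ ((n - 3)./2 - j) * 'C(n, 2 * j + 1)%:Z
        * (if j \in J then Sincr n a (t %/ n.-1 ^ (n.-1 - 2 * j)) else 0)).

Section SignedNu.

Variables (n : nat) (J : {pred nat}).
Hypotheses (n_gt2 : (2 < n)%N) (n_odd : odd n).
Hypothesis recS : forall x : nat, (1 <= x)%N ->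
     \sum_(0 <= j < n.-1./2.+1)
        (-1) ^+ j * 'C(n, 2 * j + 1)%:Z * Snj n 0 (n.-1 ^ (2 * j) * x)
     = \sum_(0 <= j < n) Snj n j x.

(** The recurrence is solved for its last term, whose binomial coefficient is 1; [q = 0], which the
    recurrence excludes, is trivial. *)
Lemma Snj0_top (q : nat) :
  Snj n 0 (n.-1 ^ n.-1 * q) =
    \sum_(0 <= j < (n - 3)./2.+1) (-1) ^+ ((n - 3)./2 - j)
        * 'C(n, 2 * j + 1)%:Z * Snj n 0 (n.-1 ^ (2 * j) * q)
    - (-1) ^+ n.-1./2 * (digit_sign n.-1 q * (odd q)%:Z).
Proof.
have Snj00 : Snj n 0 0 = 0 by rewrite /Snj big_geq.
have [->|q_gt0] := posnP q.
  rewrite muln0 Snj00 big1 ?mulr0 ?subr0 // => j _.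
  by rewrite muln0 Snj00 mulr0.
have b_gt1 : (1 < n.-1)%N by lia.
have b_even : ~~ odd n.-1 by lia.
have := recS q_gt0; rewrite sum_Snj; last by lia.
rewrite sum_digit_sign //.
have -> : n.-1./2 = (n - 3)./2.+1 by lia.
rewrite big_nat_recr //=; set m := (n - 3)./2.
have -> : (2 * m.+1 + 1 = n)%N by lia.
have -> : (2 * m.+1 = n.-1)%N by lia.
rewrite binn mulr1 => rec.
(* Multiplying by the sign of the last term isolates it, this sign being its own inverse. *)
apply: (mulrI (unitrX m.+1 (unitrN1 _))).
rewrite mulrBr mulrA -expr2 sqrr_sign mul1r -[RHS]addrC -{}rec addrAC.
rewrite -[LHS]add0r; congr (_ + _).
rewrite mulr_sumr -big_split big_nat_cond big1 // => j.
rewrite andbT => /andP[_ lt_jm].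
rewrite !mulrA -exprD (_ : (-1) ^+ (m.+1 + (m - j)) = - (-1) ^+ j :> int).
  by rewrite /= !mulNr addrN.
have -> : (m.+1 + (m - j) = (m - j).*2 + j.+1)%N by lia.
by rewrite exprD -mul2n exprM sqrrN expr1n mul1r exprS mulN1r.
Qed.

Lemma signed_nuJ (x : nat) :
  digit_sign n.-1 x * nuJ n J x =
    nuJ_reduced n J (x %/ n.-1 ^ n.-1) (odd (x %/ n.-1 ^ n.-1)) (x %% n.-1 ^ n.-1).
Proof.
have b_gt1 : (1 < n.-1)%N by lia.
have b_gt0 := ltnW b_gt1.
have b_even : ~~ odd n.-1 by lia.
set M := (n.-1 ^ n.-1)%N; set q := (x %/ M)%N; set t := (x %% M)%N.
have M_gt0 : (0 < M)%N by rewrite expn_gt0 b_gt0.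
have lt_tM : (t < M)%N by rewrite ltn_mod.
have def_x : x = (M * q + t)%N by rewrite mulnC -divn_eq.
have sgx : digit_sign n.-1 x = digit_sign n.-1 q * digit_sign n.-1 t.
  by rewrite {1}def_x digit_sign_cat.
have defSigma : SigmaJ n J x =
    \sum_(0 <= j < (n - 3)./2.+1) (-1) ^+ ((n - 3)./2 - j)
        * 'C(n, 2 * j + 1)%:Z * Snj n 0 (n.-1 ^ (2 * j) * q)
  + digit_sign n.-1 q * \sum_(0 <= j < (n - 3)./2.+1)
      (-1) ^+ ((n - 3)./2 - j) * 'C(n, 2 * j + 1)%:Z
        * (if j \in J then Sincr n q (t %/ n.-1 ^ (n.-1 - 2 * j)) else 0).
  rewrite /SigmaJ mulr_sumr -big_split /=; apply: eq_big_nat => j /andP[_ lt_j].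
  rewrite /Tj -/M -/q; case: ifP => _; last by rewrite !mulr0 addr0.
  have le_jb : (2 * j <= n.-1)%N by lia.
  rewrite (divn_expn_split x b_gt0 le_jb) -/M -/q -/t Snj0_cat //; first by ring.
    by rewrite mul2n odd_double.
  by rewrite ltn_divLR ?expn_gt0 ?b_gt0 // -expnD subnKC.
(* The sum supplied by [Snj0_top] is the first sum of [defSigma], so the two cancel; every remaining
   term carries the sign of [q], which squares to 1. *)
rewrite /nuJ defSigma {1}sgx {1}def_x Snj0_cat // Snj0_top /nuJ_reduced.
set A := \sum_(_ <= _ < _) _ ; set B := \sum_(_ <= _ < _) _.
set s := digit_sign _ q; set u := digit_sign _ t.
have ss : s * s = 1 by exact: digit_sign_sqr.
set P := Sincr _ _ _; set E := (-1) ^+ _; set o := _%:Z.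
rewrite (_ : s * u * _ = (s * s) * (u * (P - E * o - B))); last by ring.
by rewrite ss mul1r.
Qed.

End SignedNu.

Theorem theorem10 (n : nat) (n_ge3 : (3 <= n)%N) (n_odd : odd n)
  (recS : forall x : nat, (1 <= x)%N ->
     \sum_(0 <= j < n.-1./2.+1)
        (-1) ^+ j * 'C(n, 2 * j + 1)%:Z * Snj n 0 (n.-1 ^ (2 * j) * x)
     = \sum_(0 <= j < n) Snj n j x)
  (J : {pred nat})
  (J_sub : forall j : nat, j \in J -> (1 <= j <= (n - 3)./2)%N) :
  forall x : nat,
    (-1) ^+ digit_sum n.-1 (x + 2 * n * n.-1 ^ n.-1)
      * nuJ n J (x + 2 * n * n.-1 ^ n.-1)
    = (-1) ^+ digit_sum n.-1 x * nuJ n J x.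
Proof.
move=> x; rewrite -!/(digit_sign _ _) !signed_nuJ //.
have M_gt0 : (0 < n.-1 ^ n.-1)%N by rewrite expn_gt0; apply/orP; left; lia.
(* The shift adds [2 * n] to the quotient by [M] and fixes the remainder. *)
rewrite addnC divnMDl // modnMDl oddD mul2n odd_double addFb.
have eq_q : (n.*2 + x %/ n.-1 ^ n.-1 = x %/ n.-1 ^ n.-1 %[mod n])%N.
  by rewrite -mul2n modnMDl.
rewrite /nuJ_reduced (Sincr_mod _ eq_q).
by under eq_bigr do rewrite (Sincr_mod _ eq_q).
Qed.
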